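(* Let $I$ be a finite nonempty set, $J$ a positive integer, $R_{\mathrm c}>1$, and let $\rho\in C^\infty(\mathbb{R};[0,1])$ satisfy $\rho(u)=1$ for $u\le-1$ and $\rho(u)=0$ for $u\ge0$. Put $\lambda_r=R_{\mathrm c}^{-r}$ for $0\le r\le J$. For $y=(y_i)_{i\in I}\in\mathbb{R}^I$ define $$A_{i,r}(y)=\lambda_r\rho(y_i+J-r),\qquad S(y)=\sum_{i\in I}\sum_{r=0}^JA_{i,r}(y).$$ Assume $|I|\lambda_J\le1$. Fix a finite $\tau_*>0$ and, for $0<\tau\le\tau_*$, define $$G_{i,r,\tau}(y)=\tau\exp(-\tau S(y))\,\lambda_r\rho'(y_i+J-r).$$ Then for every nonnegative integer $m$ there is a finite constant $C_{m,\tau_*}$, depending only on $m$, $\tau_*$, $R_{\mathrm c}$ and $\max_{1\le k\le m+1}\|\rho^{(k)}\|_\infty$, such that $$\sum_{i_0\in I}\sum_{r_0=0}^J\sum_{i_1,\ldots,i_m\in I}\left|\partial_{y_{i_1}}\cdots\partial_{y_{i_m}}G_{i_0,r_0,\tau}(y)\right|\le C_{m,\tau_*}$$ for every $y\in\mathbb{R}^I$ and $0<\tau\le\tau_*$ (when $m=0$, the last index sum and the derivatives are omitted). Moreover, let $\delta>0$ and $a_i\in\mathbb{R}$ for $i\in I$, and put $y_i(q)=(q_i-a_i)/\delta$ and $\widetilde G_{i,r,\tau}(q)=\delta^{-1}G_{i,r,\tau}(y(q))$. Then the left side of the preceding display, with $\widetilde G$ and $q$-derivatives in place of $G$ and $y$-derivatives,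 is at most $C_{m,\tau_*}\delta^{-(m+1)}$. Finally, if two disjoint copies of this construction are used (with disjoint sets of spectral variables $q$, $q'$, and possibly different finite index sets, depths $J,J'$, scales $\delta,\delta'$, and Laplace parameters $\tau,\tau'\in(0,\tau_*]$), then the $\ell^1$-sum (over all indices of both copies) of any mixed derivative tensor, of order $m$ in $q$ and $m'$ in $q'$, of $\widetilde G_{i,r,\tau}(q)\,\widetilde G'_{j,s,\tau'}(q')$ is bounded by the product of the two corresponding one-copy bounds $C_{m,\tau_*}\delta^{-(m+1)}$ and $C_{m',\tau_*}(\delta')^{-(m'+1)}$.
   Context: $\|\cdot\|_\infty$ is the supremum norm on $\mathbb{R}$ and $\rho^{(k)}$ the $k$-th derivative. *)

(* Defs.v *)
From HB Require Import structures.
From mathcomp Require Import all_boot all_order all_algebra.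
From mathcomp Require Import all_classical all_reals all_analysis.

Set Implicit Arguments.
Unset Strict Implicit.
Unset Printing Implicit Defensive.

Import Order.TTheory GRing.Theory Num.Theory.
Import numFieldNormedType.Exports.

Local Open Scope classical_set_scope.
Local Open Scope ring_scope.

(* [derive] requires a normed domain, and [I -> R] carries no norm in the
   library, so partial derivatives are derivatives of coordinate slices. *)
Definition partial (R : realType) (I : finType) (i : I)
    (f : (I -> R) -> R) : (I -> R) -> R :=
  fun y => derive1 (fun t : R => f (fun j => if j == i then t else y j)) (y i).

(* [:: i_1; ...; i_m] gives d_(i_1) (d_(i_2) (... (d_(i_m) f))). *)
Definition partials (R : realType) (I : finType) (s : seq I)
    (f : (I -> R) -> R) : (I -> R) -> R :=
  foldr (@partial R I) f s.

Definition smooth (R : realType) (f : R -> R) : Prop :=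
  forall (n : nat) (x : R), derivable (derive1n n f) x 1.

(* [sup] of an unbounded set is 0; here the norm is only applied to
   derivatives of smooth functions that are constant outside [-1, 0],
   which are bounded. *)
Definition supnorm (R : realType) (f : R -> R) : R :=
  sup (range (fun u : R => `|f u|)).

Definition cutoff (R : realType) (rho : R -> R) : Prop :=
  [/\ smooth rho,
      forall u, 0 <= rho u <= 1,
      forall u, u <= -1 -> rho u = 1 &
      forall u, 0 <= u -> rho u = 0].

Definition max_deriv_norm (R : realType) (rho : R -> R) (m : nat) : R :=
  \big[Num.max/0]_(1 <= k < m.+2) supnorm (derive1n k rho).

Definition lambda (R : realType) (Rc : R) (r : nat) : R := Rc ^- r.

Definition A (R : realType) (I : finType) (Rc : R) (rho : R -> R) (J : nat)
    (i : I) (r : nat) (y : I -> R) : R :=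
  lambda Rc r * rho (y i + J%:R - r%:R).

Definition Ssum (R : realType) (I : finType) (Rc : R) (rho : R -> R) (J : nat)
    (y : I -> R) : R :=
  \sum_(i : I) \sum_(r < J.+1) A Rc rho J i r y.

Definition G (R : realType) (I : finType) (Rc : R) (rho : R -> R) (J : nat)
    (tau : R) (i : I) (r : nat) (y : I -> R) : R :=
  tau * expR (- tau * Ssum Rc rho J y)
    * (lambda Rc r * derive1 rho (y i + J%:R - r%:R)).

Definition Gtilde (R : realType) (I : finType) (Rc : R) (rho : R -> R) (J : nat)
    (delta : R) (a : I -> R) (tau : R) (i : I) (r : nat) (q : I -> R) : R :=
  delta^-1 * G Rc rho J tau i r (fun k => (q k - a k) / delta).

(* The joint variable of two copies is a point [z] of R^(I + I'), with
   q = z \o inl and q' = z \o inr. *)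
Definition Gtilde2 (R : realType) (I I' : finType) (Rc : R) (rho : R -> R)
    (J J' : nat) (delta delta' : R) (a : I -> R) (a' : I' -> R) (tau tau' : R)
    (i : I) (r : nat) (j : I') (s : nat) (z : I + I' -> R) : R :=
  Gtilde Rc rho J delta a tau i r (z \o inl)
    * Gtilde Rc rho J' delta' a' tau' j s (z \o inr).

(* Main.v *)
(* Let N_m f (y) be the l1-norm of the m-th derivative tensor of f at y. It is
   subadditive, obeys the Leibniz bound N_m (f g) <= sum_j C(m,j) N_j f N_(m-j) g,
   and reduces to |phi^(m) (y_i)| when f y = phi (y_i). Put E = exp (- tau S), so
   that d_i E = - sum_r G_(i,r) and G_(i,r) = tau lambda_r rho'(y_i + J - r) E.
   The terms lambda_r |rho^(k)(y_i + J - r)|, 1 <= k <= m + 1, sum over (i, r) to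
   at most M (Rc S + 1), where M is the largest of the sup norms. With
   b = tau M (Rc S + 1), induction gives N_m E <= m! (1 + b)^m E and
   sum_(i,r) N_m G_(i,r) <= (m + 1)! (1 + b)^(m + 1) E, and the factor
   E = exp (- tau S) absorbs the power of tau S contained in b. Rescaling is the
   chain rule, and for two copies every mixed derivative is a product. *)
Require Import Defs.
From HB Require Import structures.
From mathcomp Require Import all_boot all_order all_algebra.
From mathcomp Require Import all_classical all_reals all_analysis.
From mathcomp Require Import ring lra.

Import Order.TTheory GRing.Theory Num.Theory.
Import numFieldNormedType.Exports.

Local Open Scope classical_set_scope.
Local Open Scope ring_scope.

Set Implicit Arguments.
Unset Strict Implicit.

(** * Partial derivatives along coordinate slices *)

Definition upd (R : realType) (I : finType) (y : I -> R) (i : I) (t : R) : I -> R :=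
  fun j => if j == i then t else y j.

Lemma upd_id (R : realType) (I : finType) (y : I -> R) i : upd y i (y i) = y.
Proof. by apply/funext => j; rewrite /upd; case: eqP => // ->. Qed.

Definition partial_derivable (R : realType) (I : finType) (f : (I -> R) -> R) :=
  forall i (y : I -> R), derivable (fun t : R => f (upd y i t)) (y i) 1.

(** [is_derive] bundles existence and value: gradients of explicit expressions are computed by
    rules, and [has_partialE] turns the result into an equality of functions that can be
    differentiated again. *)
Definition has_partial (R : realType) (I : finType) (f : (I -> R) -> R)
    (d : I -> (I -> R) -> R) :=
  forall i (y : I -> R), is_derive (y i) (1 : R) (fun t : R => f (upd y i t)) (d i y).

Lemma has_partialP (R : realType) (I : finType) (f : (I -> R) -> R) :
  partial_derivable f -> has_partial f (fun i => partial i f).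
Proof.
by move=> fd i y; have := derivableP (fd i y); rewrite -derive1E.
Qed.

Lemma has_partial_derivable (R : realType) (I : finType) (f : (I -> R) -> R) d :
  has_partial f d -> partial_derivable f.
Proof. by move=> fd i y; have [] := fd i y. Qed.

Lemma has_partialE (R : realType) (I : finType) (f : (I -> R) -> R) d i :
  has_partial f d -> partial i f = d i.
Proof.
by move=> fd; apply/funext => y; rewrite /partial derive1E; have [_ ->] := fd i y.
Qed.

(** [partial] is total and carries no information where a slice is not derivable, so this predicate
    records that all iterated partials up to order n exist. *)
Fixpoint psmooth (R : realType) (I : finType) (n : nat) (f : (I -> R) -> R) : Prop :=
  if n is n'.+1 then partial_derivable f /\ forall i, psmooth n' (partial i f)
  else True.

Lemma psmoothS (R : realType) (I : finType) n (f : (I -> R) -> R) d :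
  has_partial f d -> (forall i, psmooth n (d i)) -> psmooth n.+1 f.
Proof.
move=> fd dn; split=> [|i]; first exact: has_partial_derivable fd.
by rewrite (has_partialE i fd).
Qed.

Lemma psmoothW (R : realType) (I : finType) n (f : (I -> R) -> R) :
  psmooth n.+1 f -> psmooth n f.
Proof.
elim: n f => [//|n IHn] f [fd fs]; split=> // i; exact/IHn/fs.
Qed.

Lemma has_partialD (R : realType) (I : finType) (f g : (I -> R) -> R) df dg :
  has_partial f df -> has_partial g dg ->
  has_partial (fun y => f y + g y) (fun i y => df i y + dg i y).
Proof. by move=> fd gd i y; apply: is_deriveD. Qed.

Lemma has_partialM (R : realType) (I : finType) (f g : (I -> R) -> R) df dg :
  has_partial f df -> has_partial g dg ->
  has_partial (fun y => f y * g y) (fun i y => df i y * g y + f y * dg i y).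
Proof.
move=> fd gd i y; apply: is_derive_eq (is_deriveM (fd i y) (gd i y)) _.
by rewrite /GRing.scale/= upd_id addrC mulrC.
Qed.

Lemma has_partial_cst (R : realType) (I : finType) (c : R) :
  has_partial (fun _ : I -> R => c) (fun _ _ => 0).
Proof. by move=> i y; apply: is_derive_cst. Qed.

Lemma psmooth_cst (R : realType) (I : finType) n (c : R) :
  psmooth n (fun _ : I -> R => c).
Proof.
elim: n c => [//|n IHn] c; apply: psmoothS (@has_partial_cst R I c) _ => i.
exact: IHn.
Qed.

Lemma psmoothD (R : realType) (I : finType) n (f g : (I -> R) -> R) :
  psmooth n f -> psmooth n g -> psmooth n (fun y => f y + g y).
Proof.
elim: n f g => [//|n IHn] f g [fd fs] [gd gs].
apply: psmoothS (has_partialD (has_partialP fd) (has_partialP gd)) _ => i.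
by apply: IHn; [exact: fs|exact: gs].
Qed.

Lemma psmooth_sum (R : realType) (I : finType) n (X : Type) (s : seq X)
    (F : X -> (I -> R) -> R) :
  (forall x, psmooth n (F x)) -> psmooth n (fun y => \sum_(x <- s) F x y).
Proof.
move=> Fs; elim: s => [|x s IHs].
  by under eq_fun do rewrite big_nil; apply: psmooth_cst.
by under eq_fun do rewrite big_cons; apply: psmoothD.
Qed.

Lemma psmoothM (R : realType) (I : finType) n (f g : (I -> R) -> R) :
  psmooth n f -> psmooth n g -> psmooth n (fun y => f y * g y).
Proof.
elim: n f g => [//|n IHn] f g fs gs; have [fd fs'] := fs; have [gd gs'] := gs.
apply: psmoothS (has_partialM (has_partialP fd) (has_partialP gd)) _ => i.
(* [psmoothW] serves the factor that the product rule leaves undifferentiated. *)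
by apply: psmoothD; apply: IHn; by [exact: fs'|exact: gs'|exact: psmoothW].
Qed.

Lemma psmooth_partials (R : realType) (I : finType) n (s : seq I)
    (f : (I -> R) -> R) :
  psmooth (size s + n) f -> psmooth n (partials s f).
Proof.
elim: s n => [//|i s IHs] n fs /=.
have [_] : psmooth n.+1 (partials s f) by apply: IHs; rewrite addnS.
exact.
Qed.

(** * The l1-norm of the derivative tensor and its Leibniz bound *)

(** The index summed first belongs to the derivative applied to f first, so differentiation rules
    for f itself can be used at each induction step. *)
Fixpoint l1norm (R : realType) (I : finType) (m : nat) (f : (I -> R) -> R)
    (y : I -> R) : R :=
  if m is m'.+1 then \sum_i l1norm m' (partial i f) y else `|f y|.

(** The last index is split off because [partials] applies that derivative first, as [l1norm]
    does. *)
Lemma big_tuple_rcons (R : nmodType) (I : finType) m (F : seq I -> R) :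
  \sum_(t : m.+1.-tuple I) F t = \sum_i \sum_(t : m.-tuple I) F (rcons t i).
Proof.
rewrite pair_big/=.
rewrite (reindex (fun p : I * m.-tuple I => [tuple of rcons p.2 p.1]))//.
(* The inverse finds the last entry as the head of the reversed tuple. *)
exists (fun t : m.+1.-tuple I =>
          (thead [tuple of rev t], [tuple of rev (behead (rev t))])).
  move=> [i t] _ /=; congr (_, _).
    by rewrite /thead (tnth_nth i)/= rev_rcons.
  by apply: val_inj; rewrite /= rev_rcons/= revK.
move=> t _; apply: val_inj => /=; rewrite -rev_cons.
have /(congr1 val)/= <- := tuple_eta [tuple of rev t].
by rewrite revK.
Qed.

(** The predicate is carried along for sums over tuples with a prescribed left-right pattern. *)
Lemma big_tuple_cons (R : nmodType) (I : finType) m (P : pred (seq I)) (F : seq I -> R) :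
  \sum_(t : m.+1.-tuple I | P t) F t =
  \sum_i \sum_(t : m.-tuple I | P (i :: t)) F (i :: t).
Proof.
rewrite pair_big_dep/=.
rewrite (reindex (fun p : I * m.-tuple I => [tuple of p.1 :: p.2]))//.
exists (fun t : m.+1.-tuple I => (thead t, [tuple of behead t])).
  by move=> [i t] _ /=; congr (_, _); apply: val_inj.
by move=> t _; apply: val_inj; case: t => [[|j s]].
Qed.

Lemma l1normE (R : realType) (I : finType) m (f : (I -> R) -> R) y :
  \sum_(t : m.-tuple I) `|partials t f y| = l1norm m f y.
Proof.
elim: m f => [|m IHm] f.
  rewrite (big_pred1 [tuple])// => t.
  exact/esym/eqP/tuple0.
rewrite (big_tuple_rcons m (fun s => `|partials s f y|)) /=; apply: eq_bigr => i _.
rewrite -IHm; apply: eq_bigr => t _.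
by rewrite /partials foldr_rcons.
Qed.

Lemma l1norm_ge0 (R : realType) (I : finType) m (f : (I -> R) -> R) y :
  0 <= l1norm m f y.
Proof. by rewrite -l1normE sumr_ge0. Qed.

Lemma l1norm_cst0 (R : realType) (I : finType) m (y : I -> R) :
  l1norm m (fun _ => 0) y = 0.
Proof.
elim: m => [|m IHm] /=; first by rewrite normr0.
by rewrite big1// => i _; rewrite (has_partialE i (@has_partial_cst R I 0)).
Qed.

Lemma l1normD (R : realType) (I : finType) m (f g : (I -> R) -> R) y :
  psmooth m f -> psmooth m g ->
  l1norm m (fun y => f y + g y) y <= l1norm m f y + l1norm m g y.
Proof.
elim: m f g => [|m IHm] f g; first by move=> _ _; exact: ler_normD.
move=> [fd fs] [gd gs] /=; rewrite -big_split; apply: ler_sum => i _ /=.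
rewrite (has_partialE i (has_partialD (has_partialP fd) (has_partialP gd))).
by apply: IHm; [exact: fs|exact: gs].
Qed.

Lemma l1norm_sum (R : realType) (I : finType) m (X : Type) (s : seq X)
    (F : X -> (I -> R) -> R) y :
  (forall x, psmooth m (F x)) ->
  l1norm m (fun y => \sum_(x <- s) F x y) y <= \sum_(x <- s) l1norm m (F x) y.
Proof.
move=> Fs; elim: s => [|x s IHs].
  by under eq_fun do rewrite big_nil; rewrite l1norm_cst0 big_nil.
under eq_fun do rewrite big_cons.
rewrite big_cons (le_trans (l1normD _ _ _)) ?lerD2l//.
exact: psmooth_sum.
Qed.

(** The recombination in the Leibniz induction: the first sum comes from differentiating the first
    factor, the second from the other one, and Pascal's rule merges them. *)
Lemma pascal_sum (R : pzRingType) m (a b : nat -> R) :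
  \sum_(j < m.+1) a j.+1 * b (m - j)%N *+ 'C(m, j)
    + \sum_(j < m.+1) a j * b (m - j).+1 *+ 'C(m, j)
  = \sum_(j < m.+2) a j * b (m.+1 - j)%N *+ 'C(m.+1, j).
Proof.
rewrite [RHS]big_ord_recl/= subn0 bin0 mulr1n.
under [in RHS]eq_bigr do rewrite /bump/= add1n subSS binS mulrnDr.
rewrite big_split/= addrA addrC; congr (_ + _).
rewrite [LHS]big_ord_recl/= subn0 bin0 mulr1n; congr (_ + _).
(* The extra last term carries the coefficient C(m, m + 1) = 0. *)
rewrite [RHS]big_ord_recr/= bin_small// mulr0n addr0.
by apply: eq_bigr => j _; rewrite /bump/= add1n -subSn ?subSS.
Qed.

Lemma l1normM (R : realType) (I : finType) m (f g : (I -> R) -> R) y :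
  psmooth m f -> psmooth m g ->
  l1norm m (fun y => f y * g y) y
    <= \sum_(j < m.+1) l1norm j f y * l1norm (m - j) g y *+ 'C(m, j).
Proof.
elim: m f g => [|m IHm] f g.
  by move=> _ _; rewrite big_ord1 bin0 mulr1n /= normrM.
move=> fs gs; have [fd fs'] := fs; have [gd gs'] := gs.
rewrite -(pascal_sum m (fun j => l1norm j f y) (fun j => l1norm j g y)) /=.
have fsW := psmoothW fs; have gsW := psmoothW gs.
have -> : \sum_(j < m.+1) (\sum_i l1norm j (partial i f) y) * l1norm (m - j) g y
      *+ 'C(m, j) = \sum_i \sum_(j < m.+1)
      l1norm j (partial i f) y * l1norm (m - j) g y *+ 'C(m, j).
  rewrite exchange_big; apply: eq_bigr => j _.
  by rewrite mulr_suml sumrMnl.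
have -> : \sum_(j < m.+1) l1norm j f y * (\sum_i l1norm (m - j) (partial i g) y)
      *+ 'C(m, j) = \sum_i \sum_(j < m.+1)
      l1norm j f y * l1norm (m - j) (partial i g) y *+ 'C(m, j).
  rewrite exchange_big; apply: eq_bigr => j _.
  by rewrite mulr_sumr sumrMnl.
rewrite -big_split; apply: ler_sum => i _ /=.
rewrite (has_partialE i (has_partialM (has_partialP fd) (has_partialP gd))).
apply: le_trans (l1normD _ _ _) _.
- by apply: psmoothM => //; exact: fs'.
- by apply: psmoothM => //; exact: gs'.
- by apply: lerD; apply: IHm => //; [exact: fs'|exact: gs'].
Qed.

(** * Functions of a single coordinate *)

Definition coord_fun (R : realType) (I : finType) (phi : R -> R) (c d : R)
  (i : I) : (I -> R) -> R := fun y => c * phi (y i + d).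

Lemma has_partial_coord (R : realType) (I : finType) (phi : R -> R) (c d : R) (i : I) :
  (forall x, derivable phi x 1) ->
  has_partial (coord_fun phi c d i)
    (fun j => if j == i then coord_fun (derive1 phi) c d i else fun=> 0).
Proof.
move=> phid j y; rewrite /coord_fun/upd; have [->|_] := eqVneq j i.
  have phiD : is_derive (y i + d) (1 : R) phi (derive1 phi (y i + d)).
    by rewrite derive1E; exact: derivableP.
  have shD : is_derive (y i) (1 : R) (fun t : R => t + d) 1.
    exact: is_derive_shift.
  have := @is_deriveZ _ _ _ _ c _ _ _ (@is_derive1_comp R phi (fun t => t + d) (y i) _ _ phiD shD).
  by rewrite /GRing.scale/= mulr1.
exact: is_derive_cst.
Qed.

Lemma psmooth_coord (R : realType) (I : finType) (phi : R -> R) (c d : R) (i : I) n :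
  smooth phi -> psmooth n (coord_fun phi c d i).
Proof.
elim: n phi => [//|n IHn] phi sphi.
apply: psmoothS (has_partial_coord c d i (sphi 0%N)) _ => j.
case: ifP => _; last exact: psmooth_cst.
by apply: IHn => k x; have := sphi k.+1 x; rewrite /derive1n iterSr.
Qed.

(** The only entry of the tensor that can be nonzero has all its indices equal to i, so no factor
    #|I| appears. *)
Lemma l1norm_coord (R : realType) (I : finType) (phi : R -> R) (c d : R) (i : I) n y :
  smooth phi -> l1norm n (coord_fun phi c d i) y = `|c * derive1n n phi (y i + d)|.
Proof.
elim: n phi => [//|n IHn] phi sphi /=.
rewrite (bigD1 i)//= big1 => [|j ji].
  rewrite (has_partialE i (has_partial_coord c d i (sphi 0%N))) eqxx addr0.
  rewrite IHn => [|k x]; first by rewrite /derive1n -iterSr.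
  by have := sphi k.+1 x; rewrite /derive1n iterSr.
rewrite (has_partialE j (has_partial_coord c d i (sphi 0%N))) (negbTE ji).
exact: l1norm_cst0.
Qed.

(** * Derivatives of the cutoff *)

(** Openness makes phi constant near each point of U, so the derivative is 0 on all of U, again a
    constant, and the induction continues. *)
Lemma derive1n_cst_on (R : realType) (U : set R) k (phi : R -> R) (c : R) :
  open U -> (forall x, U x -> phi x = c) ->
  forall x, U x -> derive1n k.+1 phi x = 0.
Proof.
move=> oU; elim: k phi c => [|k IHk] phi c phic x Ux.
  rewrite derive1n1 derive1E (@near_eq_derive _ _ _ _ (cst c)) ?derive_cst//.
  by apply: filterS (open_nbhs_nbhs (conj oU Ux)) => z; exact: phic.
rewrite /derive1n iterSr; apply: (IHk _ 0) => // z Uz; rewrite derive1E.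
rewrite (@near_eq_derive _ _ _ _ (cst c)) ?derive_cst//.
by apply: filterS (open_nbhs_nbhs (conj oU Uz)) => w; exact: phic.
Qed.

Lemma cutoff_deriv_lt (R : realType) (rho : R -> R) k (u : R) :
  cutoff rho -> u < -1 -> derive1n k.+1 rho u = 0.
Proof.
move=> [_ _ rho1 _]; apply: (@derive1n_cst_on _ [set x | x < -1] _ _ 1) => [|x /= /ltW].
  exact: open_lt.
exact: rho1.
Qed.

Lemma cutoff_deriv_gt (R : realType) (rho : R -> R) k (u : R) :
  cutoff rho -> 0 < u -> derive1n k.+1 rho u = 0.
Proof.
move=> [_ _ _ rho0]; apply: (@derive1n_cst_on _ [set x | 0 < x] _ _ 0) => [|x /= /ltW].
  exact: open_gt.
exact: rho0.
Qed.

(** A [sup] dominates its set only when the set is bounded. Here it is: the derivative is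
    continuous, hence bounded on [-1, 0], and vanishes outside. *)
Lemma cutoff_deriv_le (R : realType) (rho : R -> R) m k (u : R) :
  cutoff rho -> (k <= m)%N -> `|derive1n k.+1 rho u| <= max_deriv_norm rho m.
Proof.
move=> rhoc km.
apply: le_trans (_ : supnorm (derive1n k.+1 rho) <= _); last first.
  apply: (@Order.TotalTheory.le_bigmax_seq _ _ _ _ _ k.+1) => //.
  by rewrite mem_index_iota.
apply: ub_le_sup; last by exists u.
have [c _ cmax] : exists2 c, c \in `[(-1 : R), 0] &
    forall t, t \in `[(-1 : R), 0] -> `|derive1n k.+1 rho t| <= `|derive1n k.+1 rho c|.
  apply: (@EVT_max R (fun t => `|derive1n k.+1 rho t|)); first by rewrite lerN10.
  apply: continuous_subspaceT => x; apply: continuous_comp; last exact: norm_continuous.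
  have [sm _ _ _] := rhoc.
  exact/differentiable_continuous/derivable1_diffP/sm.
exists `|derive1n k.+1 rho c| => _ [t _ <-].
have [t1|t1] := ltP t (-1); first by rewrite cutoff_deriv_lt// normr0.
have [t0|t0] := ltP 0 t; first by rewrite cutoff_deriv_gt// normr0.
by apply: cmax; rewrite in_itv/= t1 t0.
Qed.

Lemma max_deriv_norm_ge0 (R : realType) (rho : R -> R) m : 0 <= max_deriv_norm rho m.
Proof. by rewrite /max_deriv_norm bigmax_ge_id. Qed.

(** * Weighted sums of cutoff derivatives against S *)

Lemma lambda_gt0 (R : realType) (Rc : R) r : 1 < Rc -> 0 < lambda Rc r.
Proof. by move=> Rc1; rewrite /lambda invr_gt0 exprn_gt0// (lt_trans ltr01). Qed.

Lemma lambda_ge0 (R : realType) (Rc : R) r : 1 < Rc -> 0 <= lambda Rc r.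
Proof. by move=> Rc1; rewrite ltW// lambda_gt0. Qed.

Lemma A_ge0 (R : realType) (I : finType) (Rc : R) (rho : R -> R) J (i : I) r y :
  1 < Rc -> cutoff rho -> 0 <= A Rc rho J i r y.
Proof.
move=> Rc1 [_ rho01 _ _]; apply: mulr_ge0; first exact: lambda_ge0.
by have /andP[] := rho01 (y i + J%:R - r%:R).
Qed.

Lemma Ssum_ge0 (R : realType) (I : finType) (Rc : R) (rho : R -> R) J (y : I -> R) :
  1 < Rc -> cutoff rho -> 0 <= Ssum Rc rho J y.
Proof.
by move=> Rc1 rhoc; do 2![apply: sumr_ge0 => ? _]; exact: A_ge0.
Qed.

(* Where rho^(k) does not vanish at depth r, the cutoff at depth r + 1 equals 1,
   so lambda_r = Rc * A_(i, r + 1); only the last depth J has no successor. *)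
Lemma sum_lambda_deriv_le (R : realType) (I : finType) (Rc : R) (rho : R -> R)
    J m k (y : I -> R) :
  1 < Rc -> cutoff rho -> #|I|%:R * lambda Rc J <= 1 -> (k <= m)%N ->
  \sum_i \sum_(r < J.+1) `|lambda Rc r * derive1n k.+1 rho (y i + (J%:R - r%:R))|
    <= max_deriv_norm rho m * (Rc * Ssum Rc rho J y + 1).
Proof.
move=> Rc1 rhoc IJ km; have M0 := max_deriv_norm_ge0 rho m.
have Rc0 : 0 < Rc by exact: lt_trans ltr01 Rc1.
set M := max_deriv_norm rho m in M0 *.
have lastr i : `|lambda Rc J * derive1n k.+1 rho (y i + (J%:R - J%:R))|
    <= M * lambda Rc J.
  rewrite normrM gtr0_norm ?lambda_gt0// mulrC ler_wpM2r ?lambda_ge0//.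
  exact: cutoff_deriv_le.
have step i r : `|lambda Rc r * derive1n k.+1 rho (y i + (J%:R - r%:R))|
    <= M * (Rc * A Rc rho J i r.+1 y).
  have [u0|u0] := ltP 0 (y i + (J%:R - r%:R)).
    rewrite cutoff_deriv_gt// mulr0 normr0.
    by apply: mulr_ge0 => //; apply: mulr_ge0; [exact: ltW|exact: A_ge0].
  rewrite normrM gtr0_norm ?lambda_gt0// mulrC.
  apply: ler_pM => //; first exact: lambda_ge0.
    exact: cutoff_deriv_le.
  have [_ _ rho1 _] := rhoc.
  rewrite /A rho1 ?mulr1; last first.
    by move: u0; rewrite -natr1; lra.
  by rewrite /lambda exprS invfM mulrA divff ?mul1r// gt_eqF.
apply: (@le_trans _ _ (\sum_i (M * (Rc * \sum_(r < J.+1) A Rc rho J i r y)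
    + M * lambda Rc J))).
  apply: ler_sum => i _; rewrite big_ord_recr/=; apply: lerD; last exact: lastr.
  apply: le_trans (ler_sum _ (fun (r : 'I_J) _ => step i r)) _.
  rewrite -!mulr_sumr; do 2!apply: ler_wpM2l => //; first exact: ltW.
  (* Passing from r to r + 1 omits only the nonnegative term at depth 0. *)
  rewrite big_ord_recl/= lerDr.
  exact: A_ge0.
(* The last layers total at most M #|I| lambda_J <= M, which is the [+ 1] of the bound. *)
rewrite big_split/= -!mulr_sumr -/(Ssum _ _ _ _) -mulrDr ler_wpM2l// lerD2l.
by rewrite sumr_const -mulr_natl.
Qed.

(** * Sums, and functions whose gradient is a multiple of themselves *)

Lemma has_partial_sum (R : realType) (I : finType) (X : Type) (s : seq X)
    (F : X -> (I -> R) -> R) dF :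
  (forall x, has_partial (F x) (dF x)) ->
  has_partial (fun y => \sum_(x <- s) F x y) (fun i y => \sum_(x <- s) dF x i y).
Proof.
move=> FdF; elim: s => [|x s IHs] i y.
  under eq_fun do rewrite big_nil.
  by rewrite big_nil; exact: is_derive_cst.
under eq_fun do rewrite big_cons.
by rewrite big_cons; apply: (has_partialD (FdF x) IHs).
Qed.

(** A bootstrap: the partials of E are smooth multiples of E, so order n for E yields order n +
    1. *)
Lemma psmooth_exp_like (R : realType) (I : finType) (X : finType)
    (K : I -> X -> (I -> R) -> R) (E : (I -> R) -> R) n :
  (forall n i x, psmooth n (K i x)) ->
  has_partial E (fun i y => \sum_x K i x y * E y) -> psmooth n E.
Proof.
move=> Ks dE; elim: n => [//|n IHn]; apply: psmoothS dE _ => i.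
by apply: psmooth_sum => x; exact: psmoothM.
Qed.

(** Used twice: with H = K it is the induction step for E itself, and with H the prefactors of [G]
    it bounds the tensors of [G]. *)
Lemma l1norm_prod_le (R : realType) (I X : finType) m
    (H : I -> X -> (I -> R) -> R) (E : (I -> R) -> R) (y : I -> R) (b e : R) :
  (forall n i x, psmooth n (H i x)) -> psmooth m E -> 0 <= b -> 0 <= e ->
  (forall k, (k <= m)%N -> \sum_i \sum_x l1norm k (H i x) y <= b) ->
  (forall k, (k <= m)%N -> l1norm k E y <= k`!%:R * (1 + b) ^+ k * e) ->
  \sum_i \sum_x l1norm m (fun y => H i x y * E y) y
    <= (m.+1)`!%:R * (1 + b) ^+ m.+1 * e.
Proof.
move=> Hs Es b0 e0 Hb Eb.
have b1 : 1 <= 1 + b by rewrite lerDl.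
apply: (@le_trans _ _ (\sum_i \sum_x \sum_(j < m.+1)
    l1norm j (H i x) y * l1norm (m - j) E y *+ 'C(m, j))).
  by do 2![apply: ler_sum => ? _]; exact: l1normM.
under eq_bigr do rewrite exchange_big/=.
rewrite exchange_big/=.
(* Each of the m + 1 Leibniz terms is at most m! (1 + b)^(m + 1) e, because C(m, j) (m - j)! = m! /
   j! <= m! and b (1 + b)^(m - j) <= (1 + b)^(m + 1). *)
apply: (@le_trans _ _ (\sum_(j < m.+1) m`!%:R * (1 + b) ^+ m.+1 * e)); last first.
  by rewrite sumr_const card_ord -[leLHS]mulr_natl !mulrA -natrM factS.
apply: ler_sum => j _; have jm : (j <= m)%N by rewrite -ltnS.
under eq_bigr do rewrite sumrMnl -mulr_suml.
rewrite sumrMnl -mulr_suml.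
apply: (@le_trans _ _ ((b * ((m - j)`!%:R * (1 + b) ^+ (m - j) * e)) *+ 'C(m, j))).
  apply: ler_wMn2r; apply: ler_pM => //; rewrite ?l1norm_ge0 ?Hb//.
    by do 2![apply: sumr_ge0 => ? _]; exact: l1norm_ge0.
  exact/Eb/leq_subr.
have -> : (b * ((m - j)`!%:R * (1 + b) ^+ (m - j) * e)) *+ 'C(m, j) =
    ('C(m, j) * (m - j)`!)%:R * (b * (1 + b) ^+ (m - j)) * e.
  by rewrite -[LHS]mulr_natl natrM; ring.
apply: ler_wpM2r => //; apply: ler_pM => //.
- by rewrite mulr_ge0// exprn_ge0// (le_trans ler01).
- rewrite ler_nat -(bin_fact jm) mulnCA leq_pmull// fact_gt0//.
- rewrite exprS; apply: ler_pM => //; rewrite ?exprn_ge0 ?(le_trans ler01)//.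
    by rewrite lerDr.
  by rewrite ler_weXn2l// leq_subr.
Qed.

(** The tensor of order m + 1 of E consists of tensors of order m of sums of products K E. Their
    Leibniz expansion involves E at every order up to m, hence the strong induction. *)
Lemma l1norm_exp_like (R : realType) (I X : finType) m
    (K : I -> X -> (I -> R) -> R) (E : (I -> R) -> R) (y : I -> R) (b : R) :
  (forall n i x, psmooth n (K i x)) ->
  has_partial E (fun i y => \sum_x K i x y * E y) -> 0 <= b ->
  (forall k, (k <= m)%N -> \sum_i \sum_x l1norm k (K i x) y <= b) ->
  l1norm m E y <= m`!%:R * (1 + b) ^+ m * `|E y|.
Proof.
move=> Ks dE b0; elim/ltn_ind: m => -[|m] IHm Kb.
  by rewrite /= fact0 expr0 !mul1r.
have Es n : psmooth n E by exact: psmooth_exp_like Ks dE.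
apply: le_trans (l1norm_prod_le Ks (Es m) b0 (normr_ge0 (E y)) _ _).
- rewrite /=; apply: ler_sum => i _; rewrite (has_partialE i dE).
  by apply: l1norm_sum => x; exact: psmoothM.
- by move=> k km; apply: Kb; exact: leqW.
- by move=> k km; apply: IHm => // j jk; apply: Kb; rewrite (leq_trans jk)// leqW.
Qed.

(** * [G] as a layer derivative times the Gibbs factor *)

(** The scalar [s] takes three values: 1 in the gradient of S, - tau in that of [gibbs], and tau in
    the prefactor of [G]. *)
Definition layer_deriv (R : realType) (I : finType) (Rc : R) (rho : R -> R) (J : nat)
    (s : R) (i : I) (r : 'I_J.+1) : (I -> R) -> R :=
  coord_fun (derive1 rho) (s * lambda Rc r) (J%:R - r%:R) i.

Lemma smooth_derive1 (R : realType) (phi : R -> R) : smooth phi -> smooth (derive1 phi).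
Proof. by move=> sphi k x; have := sphi k.+1 x; rewrite /derive1n iterSr. Qed.

Lemma has_partial_Ssum (R : realType) (I : finType) (Rc : R) (rho : R -> R) J :
  smooth rho ->
  has_partial (@Ssum R I Rc rho J)
    (fun i y => \sum_(r < J.+1) layer_deriv Rc rho 1 i r y).
Proof.
move=> sm i y.
have AE (k : I) (r : 'I_J.+1) :
    A Rc rho J k r = coord_fun rho (lambda Rc r) (J%:R - r%:R) k.
  by apply/funext => z; rewrite /A /coord_fun addrA.
have Ad (k : I) (r : 'I_J.+1) := has_partial_coord (lambda Rc r) (J%:R - r%:R) k (sm 0%N).
have := @has_partial_sum R I _ (index_enum I) _ _ (fun k =>
  @has_partial_sum R I _ (index_enum 'I_J.+1) _ _ (Ad k)) i y.
rewrite (bigD1 i)//= [X in _ + X]big1 ?addr0; last first.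
  by move=> k ki; rewrite big1// => r _; rewrite eq_sym (negbTE ki).
under [in X in is_derive _ _ _ X -> _]eq_bigr do rewrite eqxx.
rewrite /Ssum /layer_deriv.
under [in X in _ -> is_derive _ _ _ X]eq_bigr do rewrite mul1r.
by move=> h; under eq_fun do (under eq_bigr do (under eq_bigr do rewrite AE)).
Qed.

Definition gibbs (R : realType) (I : finType) (Rc : R) (rho : R -> R) (J : nat)
    (tau : R) : (I -> R) -> R := fun y => expR (- tau * Ssum Rc rho J y).

Lemma has_partial_gibbs (R : realType) (I : finType) (Rc : R) (rho : R -> R) J tau :
  smooth rho ->
  has_partial (@gibbs R I Rc rho J tau)
    (fun i y => \sum_(r < J.+1) layer_deriv Rc rho (- tau) i r y * gibbs Rc rho J tau y).
Proof.
move=> sm i y; have Sd := has_partial_Ssum (I := I) Rc J sm i y.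
have := @is_deriveZ _ _ _ _ (- tau) _ _ _ Sd => Sd'.
have := @is_derive1_comp R expR (fun t => - tau * Ssum Rc rho J (upd y i t)) (y i) _ _
  (is_derive_expR _) Sd'.
move=> /is_derive_eq; apply; rewrite upd_id /gibbs -mulr_suml mulrC; congr (_ * _).
rewrite /GRing.scale/= mulr_sumr; apply: eq_bigr => r _.
by rewrite /layer_deriv /coord_fun mul1r mulrA.
Qed.

Lemma GE (R : realType) (I : finType) (Rc : R) (rho : R -> R) J tau (i : I) (r : 'I_J.+1) :
  G Rc rho J tau i r =
  (fun y => layer_deriv Rc rho tau i r y * gibbs Rc rho J tau y).
Proof.
by apply/funext => y; rewrite /G /layer_deriv /coord_fun /gibbs addrA; ring.
Qed.

Lemma psmooth_layer (R : realType) (I : finType) (Rc : R) (rho : R -> R) J s (i : I)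
    (r : 'I_J.+1) n : smooth rho -> psmooth n (layer_deriv Rc rho s i r).
Proof. by move=> sm; apply/psmooth_coord/smooth_derive1. Qed.

Lemma psmooth_G (R : realType) (I : finType) (Rc : R) (rho : R -> R) J tau (i : I)
    (r : 'I_J.+1) n : smooth rho -> psmooth n (G Rc rho J tau i r).
Proof.
move=> sm; rewrite GE; apply: psmoothM; first exact: psmooth_layer.
apply: (psmooth_exp_like (K := fun i r => layer_deriv Rc rho (- tau) i r)).
  by move=> *; exact: psmooth_layer.
exact: has_partial_gibbs.
Qed.

Lemma sum_l1norm_layer_le (R : realType) (I : finType) (Rc : R) (rho : R -> R)
    J m k s (y : I -> R) :
  1 < Rc -> cutoff rho -> #|I|%:R * lambda Rc J <= 1 -> (k <= m)%N ->
  \sum_(i : I) \sum_(r < J.+1) l1norm k (layer_deriv Rc rho s i r) y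
    <= `|s| * (max_deriv_norm rho m * (Rc * Ssum Rc rho J y + 1)).
Proof.
move=> Rc1 rhoc IJ km; have [sm _ _ _] := rhoc.
apply: le_trans (ler_wpM2l (normr_ge0 s) (sum_lambda_deriv_le y Rc1 rhoc IJ km)).
rewrite mulr_sumr; apply: ler_sum => i _; rewrite mulr_sumr; apply: ler_sum => r _.
rewrite l1norm_coord; last exact: smooth_derive1.
by rewrite -mulrA normrM /derive1n -iterSr.
Qed.

(** * The one-copy bound *)

(** x^n / n! is a single term of the exponential series. *)
Lemma exprn_le_fact_expR (R : realType) n (x : R) : 0 <= x -> x ^+ n <= n`!%:R * expR x.
Proof.
case: n => [|n] x0; first by rewrite expr0 fact0 mul1r -expR0 ler_expR.
rewrite mulrC -ler_pdivrMr ?ltr0n ?fact_gt0//.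
by apply: le_trans (expR_ge1Dxn n x0); rewrite lerDr.
Qed.

(** One (m + 1)! comes from the Leibniz bound, the other from x^(m + 1) <= (m + 1)! exp x with x =
    tau S + 1 + taustar; (1 + M) Rc comes from 1 + b <= (1 + M) Rc x, and the exponential is exp (x
    - tau S). *)
Definition tensor_const (R : realType) (m : nat) (taustar Rc M : R) : R :=
  m.+1`!%:R ^+ 2 * ((1 + M) * Rc) ^+ m.+1 * expR (1 + taustar).

Lemma tensor_bound (R : realType) (I : finType) (Rc : R) (rho : R -> R)
    (J m : nat) (taustar tau : R) (y : I -> R) :
  1 < Rc -> cutoff rho -> #|I|%:R * lambda Rc J <= 1 -> 0 < tau <= taustar ->
  \sum_(i : I) \sum_(r < J.+1) l1norm m (G Rc rho J tau i r) y
    <= tensor_const m taustar Rc (max_deriv_norm rho m).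
Proof.
move=> Rc1 rhoc IJ /andP[tau0 taule]; have [sm _ _ _] := rhoc.
have M0 := max_deriv_norm_ge0 rho m; have S0 := Ssum_ge0 J y Rc1 rhoc.
set M := max_deriv_norm rho m in M0 *; set S := Ssum Rc rho J y in S0 *.
pose b := tau * (M * (Rc * S + 1)).
have Rc0 : 0 <= Rc by rewrite ltW// (lt_trans ltr01).
have tau0' : 0 <= tau by exact: ltW.
have taustar0 : 0 <= taustar by exact: le_trans taule.
have b0 : 0 <= b by rewrite /b mulr_ge0// mulr_ge0// addr_ge0// mulr_ge0.
(* Both signs share the bound b: s = - tau serves [gibbs], s = tau serves [G]. *)
have layer s k : `|s| = tau -> (k <= m)%N ->
    \sum_(i : I) \sum_(r < J.+1) l1norm k (layer_deriv Rc rho s i r) y <= b.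
  by move=> sE km; rewrite /b -sE; exact: sum_l1norm_layer_le.
have tauE : `|tau| = tau by rewrite gtr0_norm.
have NtauE : `|- tau| = tau by rewrite normrN.
have layer_smooth s n (i : I) (r : 'I_J.+1) : psmooth n (layer_deriv Rc rho s i r).
  exact: psmooth_layer.
have dgibbs := has_partial_gibbs (I := I) Rc J tau sm.
have gibbs_le k : (k <= m)%N ->
    l1norm k (gibbs Rc rho J tau) y <= k`!%:R * (1 + b) ^+ k * `|gibbs Rc rho J tau y|.
  move=> km; apply: l1norm_exp_like (layer_smooth _) dgibbs b0 _ => j jk.
  by apply: layer => //; exact: leq_trans km.
have gibbs_smooth : psmooth m (@gibbs R I Rc rho J tau).
  exact: psmooth_exp_like (layer_smooth _) dgibbs.
have := l1norm_prod_le (layer_smooth tau) gibbs_smooth b0 (normr_ge0 _)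
  (fun k => layer tau k tauE) gibbs_le.
under eq_bigr do under eq_bigr do rewrite -GE.
move=> /le_trans; apply.
rewrite /gibbs gtr0_norm ?expR_gt0// -/S.
(* The offset lets (1 + M) Rc x dominate the terms 1 and tau M of 1 + b even where S vanishes. *)
set x := tau * S + (1 + taustar).
have x0 : 0 <= x.
  by rewrite /x addr_ge0// ?mulr_ge0// addr_ge0.
have bx : 1 + b <= ((1 + M) * Rc) * x.
  rewrite /b /x; have tauS0 : 0 <= tau * S by exact: mulr_ge0.
  have taus0 : 0 <= taustar - tau by rewrite subr_ge0.
  have Rc1' : 0 <= Rc - 1 by rewrite subr_ge0 ltW.
  (* The excess over 1 + b is displayed as a sum of products of nonnegative quantities. *)
  have -> : ((1 + M) * Rc) * (tau * S + (1 + taustar)) =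
     1 + tau * (M * (Rc * S + 1)) + (Rc * (tau * S) + (Rc - 1) + Rc * taustar
       + M * Rc + M * (Rc - 1) * taustar + M * (taustar - tau)) by ring.
  rewrite lerDl; move: (Rc - 1) (taustar - tau) Rc1' taus0 => u v u0 v0.
  by do ![apply: addr_ge0 => //]; do ![apply: mulr_ge0 => //].
apply: (@le_trans _ _ (m.+1`!%:R * (((1 + M) * Rc) * x) ^+ m.+1 * expR (- tau * S))).
  apply: ler_wpM2r; first exact: expR_ge0.
  by apply: ler_wpM2l => //; rewrite lerXn2r// nnegrE ?addr_ge0// (le_trans _ bx)// addr_ge0.
rewrite exprMn /tensor_const.
(* Multiplying by exp (- tau S) cancels S from the exponent, so the bound is uniform in y, I and
   J. *)
have := exprn_le_fact_expR m.+1 x0.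
rewrite -(ler_pM2r (expR_gt0 (- tau * S))) -[leRHS]mulrA -expRD.
have -> : x + - tau * S = 1 + taustar by rewrite /x; ring.
have K0 : 0 <= m.+1`!%:R * ((1 + M) * Rc) ^+ m.+1.
  by rewrite mulr_ge0// exprn_ge0// mulr_ge0// addr_ge0.
move=> /(ler_wpM2l K0).
set e1 := expR _; set e2 := expR _; set K := (_ * Rc) ^+ _; move=> h.
have -> : m.+1`!%:R * (K * x ^+ m.+1) * e1 = m.+1`!%:R * K * (x ^+ m.+1 * e1) by ring.
by apply: le_trans h _; rewrite expr2 le_eqVlt; apply/orP; left; apply/eqP; ring.
Qed.

(** * Affine rescaling *)

(** The prefactor [c] makes the rule iterable: each derivative replaces c by c / delta. *)
Lemma has_partial_affine (R : realType) (I : finType) (f : (I -> R) -> R)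
    (c delta : R) (a : I -> R) :
  partial_derivable f ->
  has_partial (fun q => c * f (fun k => (q k - a k) / delta))
    (fun i q => c / delta * partial i f (fun k => (q k - a k) / delta)).
Proof.
move=> fd i q; set y := fun k => (q k - a k) / delta.
have -> : (fun t => c * f (fun k => (upd q i t k - a k) / delta)) =
    (fun t => c * f (upd y i ((t - a i) / delta))).
  apply/funext => t; congr (_ * f _); apply/funext => k.
  by rewrite /upd /y; case: eqP => // ->.
have affine : is_derive (q i) (1 : R) (fun t : R => (t - a i) / delta) delta^-1.
  have -> : (fun t : R => (t - a i) / delta) = delta^-1 \*: shift (- a i).
    by apply/funext => t; rewrite mulrC.
  have := @is_deriveZ _ _ _ _ delta^-1 _ _ _ (is_derive_shift (q i) (1 : R) (- a i)).
  by rewrite /GRing.scale/= mulr1.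
have := @is_deriveZ _ _ _ _ c _ _ _ (@is_derive1_comp R (fun u => f (upd y i u))
  (fun t : R => (t - a i) / delta) (q i) _ _ (has_partialP fd i y) affine).
by move=> /is_derive_eq; apply; rewrite /GRing.scale/=; ring.
Qed.

Lemma psmooth_affine (R : realType) (I : finType) n (f : (I -> R) -> R)
    (c delta : R) (a : I -> R) :
  psmooth n f -> psmooth n (fun q => c * f (fun k => (q k - a k) / delta)).
Proof.
elim: n f c => [//|n IHn] f c [fd fs].
apply: psmoothS (has_partial_affine c delta a fd) _ => i.
by apply: IHn; exact: fs.
Qed.

Lemma partials_affine (R : realType) (I : finType) (f : (I -> R) -> R)
    (c delta : R) (a : I -> R) (s : seq I) :
  (forall n, psmooth n f) ->
  partials s (fun q => c * f (fun k => (q k - a k) / delta)) =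
  (fun q => c * delta ^- size s * partials s f (fun k => (q k - a k) / delta)).
Proof.
move=> fs; elim: s => [|i s IHs] /=; first by rewrite expr0 invr1 mulr1.
(* One order beyond [size s] makes [partials s f] itself derivable. *)
rewrite IHs; have [sd _] := psmooth_partials (fs (size s + 1)%N).
rewrite (has_partialE i (has_partial_affine (c * delta ^- size s) delta a sd)).
by apply/funext => q; rewrite exprSr invfM mulrA.
Qed.

(** The m derivatives give delta^-m, and the prefactor of [Gtilde] one more power. *)
Lemma Gtilde_l1norm (R : realType) (I : finType) (Rc : R) (rho : R -> R)
    (J m : nat) (delta : R) (a : I -> R) tau (i : I) (r : 'I_J.+1) q :
  smooth rho -> 0 < delta ->
  \sum_(t : m.-tuple I) `|partials t (Gtilde Rc rho J delta a tau i r) q|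
  = l1norm m (G Rc rho J tau i r) (fun k => (q k - a k) / delta) * delta ^- m.+1.
Proof.
move=> sm delta0; rewrite -l1normE mulr_suml; apply: eq_bigr => t _.
rewrite partials_affine => [|n]; last exact: psmooth_G.
rewrite size_tuple -invfM -exprS normrM (@ger0_norm _ (delta ^- m.+1)) 1?mulrC//.
by rewrite invr_ge0 exprn_ge0// ltW.
Qed.

Lemma Gtilde_tensor_bound (R : realType) (I : finType) (Rc : R) (rho : R -> R)
    (J m : nat) (taustar tau delta : R) (a q : I -> R) :
  1 < Rc -> cutoff rho -> #|I|%:R * lambda Rc J <= 1 -> 0 < tau <= taustar ->
  0 < delta ->
  \sum_(i : I) \sum_(r < J.+1) \sum_(t : m.-tuple I)
    `|partials t (Gtilde Rc rho J delta a tau i r) q|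
  <= tensor_const m taustar Rc (max_deriv_norm rho m) * delta ^- m.+1.
Proof.
move=> Rc1 rhoc IJ tauP delta0; have [sm _ _ _] := rhoc.
under eq_bigr => i _ do (under eq_bigr => r _ do rewrite Gtilde_l1norm//;
  rewrite -mulr_suml).
rewrite -mulr_suml; apply: ler_wpM2r; first by rewrite invr_ge0 exprn_ge0// ltW.
exact: tensor_bound.
Qed.

(** * Two copies: mixed derivatives and interleaved index tuples *)

(** Under [pmap], this and [right_part] extract from a list of joint indices those of each copy, in
    their original order. *)
Definition left_part (X Y : Type) (x : X + Y) : option X :=
  if x is inl i then Some i else None.

Definition right_part (X Y : Type) (x : X + Y) : option Y :=
  if x is inr j then Some j else None.

Lemma has_partial_tensor (R : realType) (I I' : finType) (f : (I -> R) -> R)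
    (g : (I' -> R) -> R) :
  partial_derivable f -> partial_derivable g ->
  has_partial (fun z : I + I' -> R => f (z \o inl) * g (z \o inr))
    (fun x z => match x with
       | inl i => partial i f (z \o inl) * g (z \o inr)
       | inr j => f (z \o inl) * partial j g (z \o inr)
     end).
Proof.
move=> fd gd [i|j] z.
- have -> : (fun t => f (upd z (inl i) t \o inl) * g (upd z (inl i) t \o inr)) =
      (fun t => g (z \o inr) * f (upd (z \o inl) i t)).
    by apply/funext => t; rewrite mulrC.
  by rewrite mulrC; apply: is_deriveZ (has_partialP fd i (z \o inl)).
- have -> : (fun t => f (upd z (inr j) t \o inl) * g (upd z (inr j) t \o inr)) =
      (fun t => f (z \o inl) * g (upd (z \o inr) j t)) by [].
  by apply: is_deriveZ (has_partialP gd j (z \o inr)).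
Qed.

(** Each derivative acts on one factor and treats the other as a constant, so the product form
    survives any interleaving. *)
Lemma partials_tensor (R : realType) (I I' : finType) (f : (I -> R) -> R)
    (g : (I' -> R) -> R) (s : seq (I + I')) :
  (forall n, psmooth n f) -> (forall n, psmooth n g) ->
  partials s (fun z : I + I' -> R => f (z \o inl) * g (z \o inr)) =
  (fun z => partials (pmap (@left_part I I') s) f (z \o inl)
            * partials (pmap (@right_part I I') s) g (z \o inr)).
Proof.
move=> fs gs; elim: s => [//|x s IHs].
rewrite [LHS]/= IHs.
have [fd _] := psmooth_partials (fs (size (pmap (@left_part I I') s) + 1)%N).
have [gd _] := psmooth_partials (gs (size (pmap (@right_part I I') s) + 1)%N).
by rewrite (has_partialE x (has_partial_tensor fd gd)); case: x.
Qed.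

(** A tuple with pattern w is the interleaving, prescribed by w, of one tuple over I and one over
    I', so the sum factors. *)
Lemma big_tuple_shuffle (R : comPzRingType) (I I' : finType) n (w : seq bool)
    (F : seq I -> R) (F' : seq I' -> R) :
  size w = n ->
  \sum_(t : n.-tuple (I + I')%type | [seq is_inl x | x <- t] == w)
    F (pmap (@left_part I I') t) * F' (pmap (@right_part I I') t)
  = (\sum_(u : (count_mem true w).-tuple I) F u)
    * (\sum_(v : (count_mem false w).-tuple I') F' v).
Proof.
move=> <-{n}; elim: w F F' => [|b w IHw] F F' /=.
  rewrite (big_pred1 [tuple]) => [|t]; last by rewrite (tuple0 t) /= !eqxx.
  rewrite (big_pred1 [tuple]) => [|t]; last exact/esym/eqP/tuple0.
  by rewrite (big_pred1 [tuple])// => t; exact/esym/eqP/tuple0.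
rewrite (big_tuple_cons (size w) (fun t => [seq is_inl x | x <- t] == b :: w)
  (fun t => F (pmap (@left_part I I') t) * F' (pmap (@right_part I I') t))).
rewrite big_sumType/=.
under eq_bigr do under eq_bigl do rewrite eqseq_cons.
under [X in _ + X]eq_bigr do under eq_bigl do rewrite eqseq_cons.
(* The first bit forces the side of the first index, so the sum over the other side is empty. *)
case: b => /=; rewrite ?add0n ?add1n.
- rewrite [X in _ + X]big1 ?addr0 => [|j _]; last by rewrite big_pred0.
  rewrite (big_tuple_cons _ xpredT) mulr_suml; apply: eq_bigr => i _.
  exact: (IHw (fun u => F (i :: u))).
- rewrite big1 ?add0r => [|i _]; last by rewrite big_pred0.
  rewrite (big_tuple_cons _ xpredT) mulr_sumr; apply: eq_bigr => j _.
  exact: (IHw _ (fun u => F' (j :: u))).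
Qed.

(* The bit sequence w records, for each of the successive derivatives of a
   mixed derivative, whether it is taken in q (true) or in q' (false). *)
Theorem lemma3p3 (R : realType) :
  exists C : nat -> R -> R -> R -> R,
  forall (Rc : R) (rho : R -> R) (taustar : R),
    1 < Rc -> cutoff rho -> 0 < taustar ->
    let B := fun m : nat => C m taustar Rc (max_deriv_norm rho m) in
    [/\ (* one copy *)
        forall (I : finType) (J m : nat),
          (0 < #|I|)%N -> (0 < J)%N -> #|I|%:R * lambda Rc J <= 1 ->
          forall (tau : R) (y : I -> R), 0 < tau <= taustar ->
          \sum_(i0 : I) \sum_(r0 < J.+1) \sum_(t : m.-tuple I)
            `|partials t (G Rc rho J tau i0 r0) y| <= B m,
        (* one copy, rescaled *)
        forall (I : finType) (J m : nat),
          (0 < #|I|)%N -> (0 < J)%N -> #|I|%:R * lambda Rc J <= 1 ->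
          forall (delta : R) (a : I -> R), 0 < delta ->
          forall (tau : R) (q : I -> R), 0 < tau <= taustar ->
          \sum_(i0 : I) \sum_(r0 < J.+1) \sum_(t : m.-tuple I)
            `|partials t (Gtilde Rc rho J delta a tau i0 r0) q|
          <= B m * delta ^- m.+1
      & (* two copies *)
        forall (I I' : finType) (J J' m m' : nat),
          (0 < #|I|)%N -> (0 < J)%N -> #|I|%:R * lambda Rc J <= 1 ->
          (0 < #|I'|)%N -> (0 < J')%N -> #|I'|%:R * lambda Rc J' <= 1 ->
          forall (delta delta' : R) (a : I -> R) (a' : I' -> R),
          0 < delta -> 0 < delta' ->
          forall (tau tau' : R) (z : I + I' -> R),
          0 < tau <= taustar -> 0 < tau' <= taustar ->
          forall w : (m + m').-tuple bool, count_mem true w = m ->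
          \sum_(i0 : I) \sum_(r0 < J.+1) \sum_(j0 : I') \sum_(s0 < J'.+1)
            \sum_(t : (m + m').-tuple (I + I')%type
                    | [seq is_inl x | x <- t] == w)
              `|partials t (Gtilde2 Rc rho J J' delta delta' a a' tau tau'
                              i0 r0 j0 s0) z|
          <= (B m * delta ^- m.+1) * (B m' * delta' ^- m'.+1)].
Proof.
exists (@tensor_const R) => Rc rho taustar Rc1 rhoc taustar0 B.
have [sm _ _ _] := rhoc; split.
- move=> I J m _ _ IJ tau y tauP.
  under eq_bigr do under eq_bigr do rewrite l1normE.
  exact: tensor_bound.
- by move=> I J m _ _ IJ delta a delta0 tau q tauP; exact: Gtilde_tensor_bound.
move=> I I' J J' m m' _ _ IJ _ _ IJ' delta delta' a a' delta0 delta'0.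
move=> tau tau' z tauP tau'P w wm.
(* The length m + m' of w fixes the number of derivatives in q'. *)
have wm' : count_mem false w = m'.
  apply: (@addnI m); rewrite -[RHS](size_tuple w) -(count_predC (pred1 true)) wm.
  by congr addn; apply: eq_count => -[].
have Gsm d (K : finType) b s L (i : K) (r : 'I_L.+1) n :
    psmooth n (Gtilde Rc rho L d b s i r).
  exact/psmooth_affine/psmooth_G.
pose N := fun (i0 : I) (r0 : 'I_J.+1) => \sum_(u : m.-tuple I)
  `|partials u (Gtilde Rc rho J delta a tau i0 r0) (z \o inl)|.
pose N' := fun (j0 : I') (s0 : 'I_J'.+1) => \sum_(v : m'.-tuple I')
  `|partials v (Gtilde Rc rho J' delta' a' tau' j0 s0) (z \o inr)|.
(* The joint sum equals the product of the one-copy sums exactly, whatever the pattern w;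
   inequalities enter only in the one-copy bounds. *)
have -> : \sum_(i0 : I) \sum_(r0 < J.+1) \sum_(j0 : I') \sum_(s0 < J'.+1)
      \sum_(t : (m + m').-tuple (I + I')%type | [seq is_inl x | x <- t] == w)
        `|partials t (Gtilde2 Rc rho J J' delta delta' a a' tau tau' i0 r0 j0 s0) z|
    = (\sum_i \sum_r N i r) * (\sum_j \sum_s N' j s).
  rewrite mulr_suml; apply: eq_bigr => i0 _.
  rewrite mulr_suml; apply: eq_bigr => r0 _.
  rewrite mulr_sumr; apply: eq_bigr => j0 _.
  rewrite mulr_sumr; apply: eq_bigr => s0 _.
  have := big_tuple_shuffle
    (fun u => `|partials u (Gtilde Rc rho J delta a tau i0 r0) (z \o inl)|)
    (fun v => `|partials v (Gtilde Rc rho J' delta' a' tau' j0 s0) (z \o inr)|)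
    (size_tuple w).
  rewrite wm wm' => <-; apply: eq_bigr => t _.
  by rewrite -normrM partials_tensor.
apply: ler_pM; try by do 3![apply: sumr_ge0 => ? _].
- exact: Gtilde_tensor_bound.
- exact: Gtilde_tensor_bound.
Qed.
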